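(* Let $E,F\subseteq\mathbb{R}^n$ be two convex bodies with $F\subseteq E$. For $\alpha>0$, $$S_\alpha(E,F)=\left(\frac{|F|}{\alpha}\right)^{\frac1\alpha}R_\alpha(E,F).$$
   Context: A convex body is a compact convex subset of $\mathbb{R}^n$ with non-empty interior; $|F|$ is $n$-dimensional Lebesgue measure. A star-shaped set $K$ (with respect to the origin) has radial function $\rho_K(x)=\sup\{\lambda\ge0:\lambda x\in K\}$. $S_\alpha(E,F)=S_\alpha(1_E,1_F)$, where $1_E,1_F$ are indicator functions and, for non-negative measurable $f,h$, $S_\alpha(f,h)$ is the star-shaped set with radial function given by $\rho_{S_\alpha(f,h)}(\xi)^\alpha=\int_0^\infty t^{\alpha-1}\int_{\mathbb{R}^n}h(x)f(x+t\xi)\,dx\,dt$ for $\xi\in\mathbb{R}^n\setminus\{0\}$. For convex bodies $F\subseteq E$ the generalized radial $\alpha$-th mean body $R_\alpha(E,F)$ is the star-shaped set with radial function given by $$\rho_{R_\alpha(E,F)}(\xi)^\alpha=\frac1{|F|}\int_F\rho_{E-x}(\xi)^\alpha\,dx,\qquad \xi\in\mathbb{S}^{n-1}.$$ *)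

(* Defs.v *)
From HB Require Import structures.
From mathcomp Require Import all_boot all_order all_algebra.
From mathcomp Require Import all_classical all_reals all_analysis.

Set Implicit Arguments.
Unset Strict Implicit.
Unset Printing Implicit Defensive.

Import Order.TTheory GRing.Theory Num.Theory.
Import numFieldNormedType.Exports.

Local Open Scope classical_set_scope.
Local Open Scope ring_scope.

(* The sigma-algebra on R^n generated by the coordinate maps, i.e. the Borel
   one, mirroring the library's instance on n.-tuple T. *)
Definition rV_display : measure_display.
Proof. exact: default_measure_display. Qed.

Section measurable_rV.
Context {R : realType} {n : nat}.

Definition rV_coord (i : 'I_n) (x : 'rV[R]_n) : measurableTypeR R := x ord0 i.

Let rV_set0 : g_sigma_preimage rV_coord set0.
Proof. exact: sigma_algebra0. Qed.

Let rV_setC A : g_sigma_preimage rV_coord A ->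
  g_sigma_preimage rV_coord (~` A).
Proof. exact: sigma_algebraC. Qed.

Let rV_bigcup (F : _^nat) : (forall i, g_sigma_preimage rV_coord (F i)) ->
  g_sigma_preimage rV_coord (\bigcup_i (F i)).
Proof. exact: sigma_algebra_bigcup. Qed.

HB.instance Definition _ := @isMeasurable.Build rV_display 'rV[R]_n
  (g_sigma_preimage rV_coord) rV_set0 rV_setC rV_bigcup.

Lemma measurable_rV_coord (i : 'I_n) : measurable_fun [set: 'rV[R]_n] (rV_coord i).
Proof.
move=> _ Y mY; rewrite setTI; apply: sub_sigma_algebra => /=.
rewrite -bigcup_seq/=; exists i => /=; first by rewrite mem_index_enum.
by exists Y => //; rewrite setTI.
Qed.

Lemma measurable_fun_rV d (T : measurableType d) (f : T -> 'rV[R]_n) :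
  (forall i, measurable_fun [set: T] (rV_coord i \o f)) ->
  measurable_fun [set: T] f.
Proof.
move=> mf _ A mA.
have : (image_set_system setT f measurable) A.
  move: mA; apply: smallest_sub.
    apply: sigma_algebra_image; exact: sigma_algebra_measurable.
  rewrite -bigcup_seq; apply: bigcup_sub => i _ B [C mC <-].
  rewrite /image_set_system/= !setTI.
  have := mf i measurableT C mC; rewrite setTI; exact.
by rewrite /image_set_system/= setTI.
Qed.

End measurable_rV.

Definition rV_cons {R : realType} {n : nat} (p : measurableTypeR R * 'rV[R]_n) :
  'rV[R]_n.+1 := row_mx (p.1)%:M p.2.

Lemma rV_cons0 (R : realType) n (p : measurableTypeR R * 'rV[R]_n) :
  rV_cons p ord0 ord0 = p.1.
Proof.
transitivity (row_mx (p.1)%:M p.2 ord0 (lshift n ord0)).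
  by congr (_ _ _); exact: val_inj.
by rewrite row_mxEl mxE eqxx mulr1n.
Qed.

Lemma rV_consS (R : realType) n (p : measurableTypeR R * 'rV[R]_n) (j : 'I_n) :
  rV_cons p ord0 (lift ord0 j) = p.2 ord0 j.
Proof.
transitivity (row_mx (p.1)%:M p.2 ord0 (rshift 1 j)).
  by congr (_ _ _); exact: val_inj.
by rewrite row_mxEr.
Qed.

Lemma measurable_rV_cons (R : realType) n :
  measurable_fun [set: measurableTypeR R * 'rV[R]_n] (@rV_cons R n).
Proof.
apply: measurable_fun_rV => i.
have [j ->|->] := unliftP ord0 i; last first.
- rewrite (_ : _ \o _ = fst); first exact: measurable_fst.
  by apply/funext => p; rewrite /= /rV_coord rV_cons0.
- rewrite (_ : _ \o _ = rV_coord j \o snd); last first.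
    by apply/funext => p; rewrite /= /rV_coord rV_consS.
  by apply: measurableT_comp; [exact: measurable_rV_coord|exact: measurable_snd].
Qed.

Section lebesgue_cons.
Context {R : realType} {n : nat}.
Variable m : {sigma_finite_measure set 'rV[R]_n -> \bar R}.

(* The product of one-dimensional Lebesgue measure with m, carried over to
   R^(n+1) = R x R^n. *)
Definition lebesgue_cons : set 'rV[R]_n.+1 -> \bar R :=
  pushforward (@lebesgue_measure R \x m)%E rV_cons.

Let lebesgue_cons0 : lebesgue_cons set0 = 0%E.
Proof. by rewrite /lebesgue_cons /pushforward preimage_set0 measure0. Qed.

Let lebesgue_cons_ge0 A : (0 <= lebesgue_cons A)%E.
Proof. by rewrite /lebesgue_cons /pushforward; apply: measure_ge0. Qed.

Let lebesgue_cons_sigma_additive : semi_sigma_additive lebesgue_cons.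
Proof.
move=> F mF tF mUF; rewrite /lebesgue_cons /pushforward preimage_bigcup.
have mC A : measurable A -> measurable ((@rV_cons R n) @^-1` A).
  by move=> mA; rewrite -[X in measurable X]setTI; exact: measurable_rV_cons.
apply: measure_semi_sigma_additive.
- by move=> k; exact: mC.
- apply/trivIsetP => i j _ _ ij; rewrite -preimage_setI.
  by move/trivIsetP : tF => /(_ _ _ I I ij) ->; rewrite preimage_set0.
- by rewrite -preimage_bigcup; exact: mC.
Qed.

HB.instance Definition _ := isMeasure.Build _ _ _ lebesgue_cons
  lebesgue_cons0 lebesgue_cons_ge0 lebesgue_cons_sigma_additive.

Let lebesgue_cons_sigma_finite : sigma_finite setT lebesgue_cons.
Proof.
have /sigma_finiteP[F [FT ndF Foo]] := sigma_finiteT (@lebesgue_measure R).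
have /sigma_finiteP[G [GT ndG Goo]] := sigma_finiteT m.
pose g (x : 'rV[R]_n.+1) : measurableTypeR R * 'rV[R]_n :=
  (x ord0 ord0, \row_j x ord0 (lift ord0 j)).
have gK : cancel rV_cons g.
  move=> [a v]; rewrite /g rV_cons0/=; congr (_, _).
  by apply/rowP => j; rewrite mxE rV_consS.
have mg : measurable_fun [set: 'rV[R]_n.+1] g.
  apply/measurable_fun_pairP; split; first exact: (measurable_rV_coord ord0).
  apply: measurable_fun_rV => i.
  rewrite (_ : _ \o _ = rV_coord (lift ord0 i)); first exact: measurable_rV_coord.
  by apply/funext => x; rewrite /rV_coord/= mxE.
exists (fun k => g @^-1` (F k `*` G k)) => [|k].
  apply/esym; rewrite -subTset => x _.
  have [i _ Fi] : (\bigcup_k F k) (g x).1 by rewrite -FT.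
  have [j _ Gj] : (\bigcup_k G k) (g x).2 by rewrite -GT.
  exists (maxn i j) => //; split.
    by move: Fi; exact/subsetPset/ndF/leq_maxl.
  by move: Gj; exact/subsetPset/ndG/leq_maxr.
have [mF Fk] := Foo k; have [mG Gk] := Goo k; split.
  by rewrite -[X in measurable X]setTI; apply: mg => //; exact: measurableX.
rewrite /lebesgue_cons /pushforward -comp_preimage.
rewrite (_ : g \o rV_cons = id); last by apply/funext => p; exact: gK.
rewrite preimage_id product_measure1E//.
by rewrite lte_mul_pinfty// ge0_fin_numE.
Qed.

HB.instance Definition _ := Measure_isSigmaFinite.Build _ _ _ lebesgue_cons
  lebesgue_cons_sigma_finite.

End lebesgue_cons.

Fixpoint lebesgue_rV (R : realType) (n : nat) :
    {sigma_finite_measure set 'rV[R]_n -> \bar R} :=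
  if n is k.+1 then lebesgue_cons (lebesgue_rV R k) else \d_(0 : 'rV[R]_0).

Lemma lebesgue_rV_box (R : realType) (n : nat) (A : 'I_n -> set (measurableTypeR R)) :
  (forall i, measurable (A i)) ->
  lebesgue_rV R n [set x | forall i, A i (x ord0 i)] =
  (\prod_(i < n) lebesgue_measure (A i))%E.
Proof.
elim: n A => [|n IH] A mA /=.
  rewrite big_ord0 diracE mem_set//; by case.
rewrite /lebesgue_cons /pushforward big_ord_recl -IH//.
rewrite -product_measure1E//.
  congr (_ _); apply/seteqP; split => [p /= Ap|[a v] /= [Aa Av] i].
    split => [|i]; first by have := Ap ord0; rewrite rV_cons0.
    by have := Ap (lift ord0 i); rewrite rV_consS.
  by have [j ->|->] := unliftP ord0 i; rewrite ?rV_cons0 ?rV_consS.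
set B := (X in measurable X).
rewrite (_ : B = \bigcap_(i in [set: 'I_n]) (rV_coord i @^-1` A (lift ord0 i))).
  apply: fin_bigcap_measurable => // i _.
  by rewrite -[X in measurable X]setTI; apply: measurable_rV_coord.
by apply/seteqP; split => [x Ax i _|x Ax i]; [exact: Ax|exact: (Ax i I)].
Qed.

Definition convex_body (R : realType) (n : nat) (K : set 'rV[R]_n) : Prop :=
  [/\ compact K, convex_set (K : set (convex_lmodType 'rV[R]_n)) & K° !=set0].

(* The norm `|x| of the library on 'rV[R]_n is the sup norm. *)
Definition enorm (R : realType) (n : nat) (x : 'rV[R]_n) : R :=
  Num.sqrt (\sum_(i < n) x ord0 i ^+ 2).

Definition star_shaped (R : realType) (n : nat) (K : set 'rV[R]_n) : Prop :=
  K 0 /\ forall x t, K x -> 0 <= t -> t <= 1 -> K (t *: x).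

Definition radial_fun (R : realType) (n : nat) (K : set 'rV[R]_n)
    (x : 'rV[R]_n) : \bar R :=
  ereal_sup [set l%:E | l in [set l | 0 <= l /\ K (l *: x)]].

(* The star-shaped set with radial function rho, where rho is a [0, +oo]-valued
   function on R^n \ {0}, positively homogeneous of degree -1. Among the sets
   with radial function rho, this is the one that meets each ray from the
   origin in a closed set. *)
Definition star_set (R : realType) (n : nat) (rho : 'rV[R]_n -> \bar R) :
  set 'rV[R]_n := [set x | x = 0 \/ (1 <= rho x)%E].

(* The extension to R^n \ {0}, positively homogeneous of degree -1, of a
   function on the Euclidean unit sphere. *)
Definition sphere_ext (R : realType) (n : nat) (rho : 'rV[R]_n -> \bar R)
    (x : 'rV[R]_n) : \bar R :=
  (((enorm x)^-1)%:E * rho ((enorm x)^-1 *: x))%E.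

Section star_set_lemmas.
Context (R : realType) (n : nat).
Implicit Types (rho : 'rV[R]_n -> \bar R) (x : 'rV[R]_n).

Lemma enorm_gt0 x : x != 0 -> 0 < enorm x.
Proof.
move=> x0; rewrite /enorm sqrtr_gt0 lt_neqAle sumr_ge0 ?andbT; last first.
  by move=> i _; exact: sqr_ge0.
apply: contra x0 => /eqP/esym/eqP; rewrite psumr_eq0 => [/allP x0|i _]; last first.
  exact: sqr_ge0.
apply/eqP/rowP => i; rewrite mxE; apply/eqP.
by have := x0 i (mem_index_enum i); rewrite sqrf_eq0.
Qed.

Lemma enormZ (c : R) x : 0 <= c -> enorm (c *: x) = c * enorm x.
Proof.
move=> c0; rewrite /enorm -[X in X * _](ger0_norm c0) -(sqrtr_sqr c).
rewrite -sqrtrM ?sqr_ge0// mulr_sumr; congr (Num.sqrt _).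
by apply: eq_bigr => i _; rewrite mxE exprMn.
Qed.

Lemma sphere_extZ rho (c : R) x : 0 < c ->
  sphere_ext rho (c *: x) = ((c^-1)%:E * sphere_ext rho x)%E.
Proof.
move=> c0; rewrite /sphere_ext enormZ ?ltW// invfM EFinM muleA; congr (_ * rho _)%E.
by rewrite scalerA mulrAC mulVf ?gt_eqF// mul1r.
Qed.

Lemma sphere_ext_unit rho x : enorm x = 1 -> sphere_ext rho x = rho x.
Proof. by move=> x1; rewrite /sphere_ext x1 invr1 scale1r mul1e. Qed.

Lemma radial_star_set rho x :
  (forall y, y != 0 -> (0 <= rho y)%E) ->
  (forall c y, 0 < c -> y != 0 -> rho (c *: y) = ((c^-1)%:E * rho y)%E) ->
  x != 0 -> radial_fun (star_set rho) x = rho x.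
Proof.
move=> rho0 rhoZ x0.
have mem l : 0 < l -> (1 <= rho (l *: x))%E = (l%:E <= rho x)%E.
  move=> l0; rewrite rhoZ// -(@lee_pmul2l _ l%:E) ?lte_fin//.
  by rewrite mule1 muleA -EFinM mulfV ?gt_eqF// mul1e.
apply/eqP; rewrite eq_le; apply/andP; split.
  apply: ge_ereal_sup => _ [l [l0 lK] <-].
  have [->|l_neq0] := eqVneq l 0; first exact: rho0.
  have {}l0 : 0 < l by rewrite lt_neqAle eq_sym l_neq0.
  rewrite -mem//; case: lK => // /eqP; rewrite scaler_eq0 (negbTE x0) orbF.
  by rewrite gt_eqF.
have in0 : [set l | 0 <= l /\ star_set rho (l *: x)] 0.
  by split => //; left; rewrite scale0r.
have inl l : 0 < l -> (l%:E <= rho x)%E -> (l%:E <= radial_fun (star_set rho) x)%E.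
  move=> l0 lx; apply: ereal_sup_ubound; exists l => //; split; first exact: ltW.
  by right; rewrite mem.
have := rho0 _ x0; case E : (rho x) => [r| |]//.
  rewrite lee_fin => r0; have [->|r_neq0] := eqVneq r 0.
    by apply: ereal_sup_ubound; exists 0.
  by apply: inl; rewrite ?E// lt_neqAle eq_sym r_neq0.
move=> _; rewrite leye_eq; apply/eqP/eqyP => r r0; apply: inl => //.
by rewrite E leey.
Qed.

Lemma star_shaped_star_set rho :
  (forall y, y != 0 -> (0 <= rho y)%E) ->
  (forall c y, 0 < c -> y != 0 -> rho (c *: y) = ((c^-1)%:E * rho y)%E) ->
  star_shaped (star_set rho).
Proof.
move=> rho0 rhoZ; split; first by left.
move=> x t Kx t0 t1; have [->|t_neq0] := eqVneq t 0.
  by left; rewrite scale0r.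
have {}t0 : 0 < t by rewrite lt_neqAle eq_sym t_neq0.
have [->|x0] := eqVneq x 0; first by left; rewrite scaler0.
case: Kx => [/eqP|x1]; first by rewrite (negbTE x0).
right; rewrite rhoZ// (le_trans x1)// -[leLHS]mul1e lee_wpmul2r ?rho0//.
by rewrite lee_fin invf_ge1.
Qed.

End star_set_lemmas.

Definition S_fun (R : realType) (n : nat) (alpha : R) (f h : 'rV[R]_n -> R) :
    set 'rV[R]_n :=
  star_set (fun xi =>
    (\int[@lebesgue_measure R]_(t in `]0%R, +oo[)
       ((t `^ (alpha - 1))%:E *
        \int[lebesgue_rV R n]_x (h x * f (x + t *: xi))%:E))
    `^ alpha^-1)%E.

Definition S_body (R : realType) (n : nat) (alpha : R) (E F : set 'rV[R]_n) :
  set 'rV[R]_n := S_fun alpha \1_E \1_F.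

Definition R_body (R : realType) (n : nat) (alpha : R) (E F : set 'rV[R]_n) :
    set 'rV[R]_n :=
  star_set (sphere_ext (fun xi =>
    (((fine (lebesgue_rV R n F))^-1)%:E *
     \int[lebesgue_rV R n]_(x in F)
       (radial_fun [set (y - x)%R | y in E] xi `^ alpha))
    `^ alpha^-1)%E).

(* Main.v *)
Require Import Defs.
From HB Require Import structures.
From mathcomp Require Import all_boot all_order all_algebra.
From mathcomp Require Import all_classical all_reals all_analysis.
From mathcomp Require Import measurable_realfun.

(** Both sides are star-shaped sets given by radial functions, which can be
    compared along a fixed direction xi. For x in F the ray t |-> x + t xi
    starts inside the compact convex set E, hence it lies in E exactly for t
    in [0, r] with r the radial function of E - x at xi; integrating
    t^(alpha-1) over ]0, r] ([integral_powR]) turns this into r^alpha /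
    alpha. Exchanging the integrals over t and x by Tonelli's theorem gives
    [integral_mean_radial]: the mean of the alpha-th powers of the radial
    functions over F is, up to the factor alpha / |F|, the double integral
    that defines the left-hand side. Taking alpha-th roots, the radial
    functions differ by the constant (|F| / alpha)^(1/alpha), and
    multiplying a radial function by a constant dilates the set
    ([star_setZ]).

    Two preliminaries are needed. The sigma-algebra on row vectors is the
    one generated by the coordinates; compact sets belong to it because
    every open set is a countable union of boxes with rational corners.
    Boxes inside and around F also show that 0 < |F| < +oo, so that dividing
    by |F| makes sense. The radial function on the right-hand side is
    prescribed on the Euclidean sphere only and extended by homogeneity;
    [mean_radialZ] shows that the formula on the sphere is already
    homogeneous, so that it holds in every direction. *)

Import Order.TTheory GRing.Theory Num.Theory.
Import numFieldNormedType.Exports.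

Local Open Scope classical_set_scope.
Local Open Scope ring_scope.

Set Implicit Arguments.
Unset Strict Implicit.
Unset Printing Implicit Defensive.

(** * Measurability and volume of compact sets *)

(** Boxes with rational corners: there are countably many of them, and they
    form a basis of the topology of row vectors. *)
Definition rat_box (R : realType) (n : nat) (ab : {ffun 'I_n -> rat * rat}) :
    set 'rV[R]_n :=
  [set x | forall i, x ord0 i \in `]ratr (ab i).1, ratr (ab i).2[].

Lemma nbhs_rat_box (R : realType) (n : nat) (x : 'rV[R]_n) (A : set 'rV[R]_n) :
  nbhs x A ->
  exists ab : {ffun 'I_n -> rat * rat}, rat_box ab x /\ rat_box ab `<=` A.
Proof.
move=> [P xP PA].
have ratP i : exists ab : rat * rat,
    (x ord0 i \in `]ratr ab.1, ratr ab.2[) /\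
    (forall y : R, (y \in `]ratr ab.1, ratr ab.2[) -> P ord0 i y).
  have /nbhs_ballP[e /= e0 eP] := xP ord0 i.
  have /rat_in_itvoo[a] : x ord0 i - e < x ord0 i by rewrite ltrBlDr ltrDl.
  rewrite in_itv/= => /andP[ea ax].
  have /rat_in_itvoo[b] : x ord0 i < x ord0 i + e by rewrite ltrDl.
  rewrite in_itv/= => /andP[xb be].
  exists (a, b); split=> [|y]; first by rewrite in_itv/= ax xb.
  rewrite in_itv/= => /andP[ay yb]; apply: eP.
  rewrite -ball_normE/= ltr_distlC.
  by rewrite (lt_trans ea ay) (lt_trans yb be).
have /choice[ab abP] := ratP.
exists (finfun ab); split=> [i|y yab].
  by rewrite ffunE; exact: (abP i).1.
apply: PA => i j; rewrite (ord1 i); apply: (abP j).2.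
by have := yab j; rewrite ffunE.
Qed.

Lemma measurable_rV_box (R : realType) (n : nat)
    (A : 'I_n -> set (measurableTypeR R)) :
  (forall i, measurable (A i)) ->
  measurable [set x : 'rV[R]_n | forall i, A i (x ord0 i)].
Proof.
move=> mA.
rewrite (_ : [set _ | _] = \bigcap_(i in [set: 'I_n]) (rV_coord i @^-1` A i)).
  apply: fin_bigcap_measurable => // i _.
  by rewrite -[X in measurable X]setTI; exact: measurable_rV_coord.
by apply/seteqP; split=> [x Ax i _|x Ax i]; [exact: Ax|exact: (Ax i I)].
Qed.

(** An open set is the union of the countably many rational boxes that it
    contains. *)
Lemma open_measurable_rV (R : realType) (n : nat) (U : set 'rV[R]_n) :
  open U -> measurable U.
Proof.
move=> oU; rewrite (_ : U = \bigcup_(ab : {ffun 'I_n -> rat * rat})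
    (if `[< rat_box ab `<=` U >] then rat_box ab else set0)).
  apply: countable_bigcupT_measurable => [|ab]; first exact: countableP.
  case: ifPn => // _; apply: (@measurable_rV_box _ _
    (fun i => [set` `]ratr (ab i).1, ratr (ab i).2[%R])) => i.
  exact: measurable_itv.
apply/seteqP; split=> [x Ux|x [ab _]].
  have /nbhs_rat_box[ab [abx abU]] : nbhs x U by exact: open_nbhs_nbhs.
  by exists ab => //; rewrite asboolT.
by case: ifPn => // /asboolP; exact.
Qed.

Lemma compact_measurable_rV (R : realType) (n : nat) (K : set 'rV[R]_n) :
  compact K -> measurable K.
Proof.
move=> /(compact_closed (@norm_hausdorff _ _)) cK; rewrite -[K]setCK.
by apply: measurableC; apply: open_measurable_rV; exact: closed_openC.
Qed.

Lemma compact_coord_bounded (R : realType) (n : nat) (K : set 'rV[R]_n) :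
  compact K -> exists M : R, forall x i, K x -> `|x ord0 i| <= M.
Proof.
move=> /compact_bounded [M [_ bM]]; exists (M + 1) => x i Kx.
have := bM (M + 1); rewrite ltrDl => /(_ ltr01 x Kx); apply: le_trans.
rewrite [leRHS]/Num.norm/= mx_normrE.
by apply/bigmax_geP; right; exists (ord0, i).
Qed.

Lemma lebesgue_rV_compact_lty (R : realType) (n : nat) (K : set 'rV[R]_n) :
  compact K -> (lebesgue_rV R n K < +oo)%E.
Proof.
move=> cK; have [M KM] := compact_coord_bounded cK.
have mI (i : 'I_n) : measurable (`[- M, M]%classic : set (measurableTypeR R)).
  exact: measurable_itv.
apply: (@le_lt_trans _ _
    (lebesgue_rV R n [set x | forall i, `[- M, M]%classic (x ord0 i)])).
  apply: le_measure; rewrite ?inE.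
  - exact: compact_measurable_rV.
  - exact: (measurable_rV_box mI).
  - by move=> x Kx i /=; rewrite in_itv/= -ler_norml; exact: KM.
rewrite (lebesgue_rV_box mI).
rewrite -ge0_fin_numE; last exact: prode_ge0.
elim/big_ind : _ => [//|a b|i _]; first exact: fin_numM.
by rewrite lebesgue_measure_itv/=; case: ifP.
Qed.

Lemma lebesgue_rV_interior_gt0 (R : realType) (n : nat) (K : set 'rV[R]_n) :
  measurable K -> K° !=set0 -> (0 < lebesgue_rV R n K)%E.
Proof.
move=> mK [x /nbhs_rat_box[ab [abx abK]]].
have mI (i : 'I_n) : measurable
    (`](ratr (ab i).1), (ratr (ab i).2)[%classic : set (measurableTypeR R)).
  exact: measurable_itv.
apply: (@lt_le_trans _ _ (lebesgue_rV R n (rat_box ab))); last first.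
  apply: le_measure; rewrite ?inE//.
  exact: (measurable_rV_box mI).
rewrite (lebesgue_rV_box mI).
elim/big_ind : _ => [|a b a0 b0|i _]; [by rewrite lte_fin|exact: mule_gt0|].
rewrite lebesgue_measure_itv/= lte_fin.
have := abx i; rewrite in_itv/= => /andP[h1 h2]; have h := lt_trans h1 h2.
by rewrite h lte_fin subr_gt0.
Qed.

(** * Integrals of powers *)

(** For a < 1 the integrand is unbounded at 0, so that the fundamental theorem
    of calculus only applies on [s, r] with s > 0; monotone convergence along
    s = r / (k + 2) then covers ]0, r]. *)
Lemma integral_powR (R : realType) (a r : R) : 0 < a -> 0 <= r ->
  (\int[lebesgue_measure]_(t in `]0%R, r]) (t `^ (a - 1))%:E =
  (r `^ a / a)%:E)%E.
Proof.
move=> a0; rewrite le_eqVlt => /predU1P[<-|r0].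
  by rewrite set_itvoc0 integral_set0 powR0 ?gt_eqF// mul0r.
(* harmonic k.+1 is 1 / (k + 2), which keeps s k strictly below r. *)
pose s (k : nat) : R := r * harmonic k.+1.
have s_gt0 k : 0 < s k by rewrite mulr_gt0// harmonic_gt0.
have s_lt k : s k < r.
  by rewrite gtr_pMr// /harmonic/= invf_lt1// ltr1n.
have s_cvg0 : s k @[k --> \oo] --> 0.
  rewrite -[0](mulr0 r); apply: cvgMr.
  by have := @cvg_harmonic R; rewrite -cvg_shiftS; exact.
have -> : `]0, r]%classic = \bigcup_k `[s k, r]%classic.
  apply/seteqP; split=> [t|t [k _]]/=; rewrite !in_itv/= => /andP[h tr].
    have [k _ /(_ k)] := (cvgr_lt _ s_cvg0 _ h).
    by move=> /(_ (leqnn k)) skt; exists k => //=; rewrite in_itv/= ltW.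
  by rewrite (lt_le_trans (s_gt0 k)).
have ndF : {homo (fun k => `[s k, r]%classic) :
    m k / (m <= k)%N >-> (m <= k)%O}.
  move=> m k mk; apply/subsetPset => t /=; rewrite !in_itv/= => /andP[h ->].
  rewrite andbT; apply: le_trans h; rewrite ler_pM2l//.
  by rewrite lef_pV2 ?posrE ?ltr0n// ler_nat.
have mF k : measurable (`[s k, r]%classic : set (measurableTypeR R)).
  exact: measurable_itv.
have intF k : (\int[lebesgue_measure]_(t in `[s k, r]) (t `^ (a - 1))%:E =
    ((r `^ a - s k `^ a) / a)%:E)%E.
  rewrite (@continuous_FTC2 _ _ (fun t => a^-1 * t `^ a))//.
  - by rewrite -EFinB -mulrBr mulrC.
  - apply: derivable_within_continuous => t; rewrite in_itv/= => /andP[skt _].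
    by apply: derivable_powR; rewrite in_itv/= andbT (lt_le_trans (s_gt0 k)).
  - have dG (t : R) : 0 < t -> derivable (fun t => a^-1 * t `^ a) t 1.
      move=> t0; apply: derivableM => //.
      by apply: derivable_powR; rewrite in_itv/= andbT.
    have cG (t : R) : 0 < t -> {for t, continuous (fun t => a^-1 * t `^ a)}.
      by move=> t0; apply/differentiable_continuous/derivable1_diffP/dG.
    split.
    + move=> t; rewrite in_itv/= => /andP[skt _].
      by apply: dG; rewrite (lt_trans (s_gt0 k)).
    + by apply: cvg_at_right_filter; exact: cG.
    + by apply: cvg_at_left_filter; exact: cG.
  - move=> t; rewrite in_itv/= => /andP[skt _].
    have t0 : 0 < t by rewrite (lt_trans (s_gt0 k)).
    rewrite derive1E deriveZ/=; last first.
      by apply: derivable_powR; rewrite in_itv/= andbT.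
    rewrite -derive1E powR_derive1 ?in_itv/= ?andbT// /GRing.scale/=.
    by rewrite mulKf ?gt_eqF.
have int_cvg : (\int[lebesgue_measure]_(t in `[s k, r]) (t `^ (a - 1))%:E)%E
    @[k --> \oo] -->
    (\int[lebesgue_measure]_(t in \bigcup_k `[s k, r]%classic)
      (t `^ (a - 1))%:E)%E.
  apply: ge0_nondecreasing_set_cvg_integral => //.
  - move=> k; apply/measurable_EFinP.
    apply: (measurable_funS measurableT) => //; exact: measurable_powR.
  - by move=> k t _; rewrite lee_fin powR_ge0.
apply: (cvg_unique (@ereal_hausdorff R) int_cvg).
rewrite /= (eq_cvg _ _ intF).
apply: cvg_EFin; first by near=> k.
rewrite /comp/=; apply: cvgMl; rewrite -[X in _ --> X]subr0.
apply: cvgB; first exact: cvg_cst.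
apply: ((cvg_at_rightP (fun x : R => x `^ a) 0 0).1 (powR_cvg0 a0)).
by split.
Unshelve. all: by end_near. Qed.

(** * Radial functions and star-shaped sets *)

(** Compactness makes the set of times at which the ray from x is in E bounded
    and closed, so that its supremum is attained; convexity makes it an
    interval starting at 0. *)
Lemma radial_fun_section (R : realType) (n : nat) (E : set 'rV[R]_n)
    (x xi : 'rV[R]_n) :
  compact E -> convex_set (E : set (convex_lmodType 'rV[R]_n)) ->
  E x -> xi != 0 ->
  exists r : R, [/\ 0 <= r, radial_fun [set y - x | y in E] xi = r%:E &
    forall t, 0 <= t -> E (x + t *: xi) <-> t <= r].
Proof.
move=> cE vE Ex xi0.
pose L := [set l | 0 <= l /\ E (x + l *: xi)].
have -> : radial_fun [set y - x | y in E] xi = ereal_sup [set l%:E | l in L].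
  rewrite /radial_fun; congr (ereal_sup [set l%:E | l in _]).
  apply/seteqP; split=> l; rewrite /= => -[l0].
    by case=> y Ey yx; split=> //; rewrite -yx addrC subrK.
  by move=> El; split=> //; exists (x + l *: xi) => //; rewrite addrC addKr.
have L0 : L 0 by split=> //; rewrite scale0r addr0.
have Lub : has_ubound L.
  have [M EM] := compact_coord_bounded cE.
  (* Along a coordinate i with xi_i <> 0 the ray leaves any slab. *)
  have [i xii] : exists i, xi ord0 i != 0.
    apply/existsP; rewrite -negb_forall; apply: contra xi0 => /forallP xi0.
    by apply/eqP/rowP => i; rewrite mxE; exact/eqP.
  exists ((M + M) / `|xi ord0 i|) => l [l0 /EM El].
  rewrite ler_pdivlMr ?normr_gt0// -[l]ger0_norm// -normrM.
  have -> : l * xi ord0 i = (x + l *: xi) ord0 i - x ord0 i.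
    by rewrite !mxE addrC addKr.
  by apply: le_trans (ler_normB _ _) _; apply: lerD; [exact: El|exact: EM].
have cL : closed L.
  have -> : L = [set l | 0 <= l] `&` ((fun l : R => x + l *: xi) @^-1` E) by [].
  apply: closedI; first exact: closed_ge.
  apply: closed_comp.
    move=> l _; apply: cvgD; first exact: cvg_cst.
    by apply: cvgZl; exact: cvg_id.
  exact: compact_closed (@norm_hausdorff _ _) cE.
have [r0 Er] : L (sup L).
  by apply: cL; apply: closure_sup => //; exists 0.
exists (sup L); split=> //; first by apply: ereal_sup_EFin => //; exists 0.
move=> t t0; split=> [Et|tr].
  by apply: ub_le_sup => //; split.
have [->|r_neq0] := eqVneq t 0; first by rewrite scale0r addr0.
have {}t0 : 0 < t by rewrite lt_neqAle eq_sym r_neq0.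
have {}r0 : 0 < sup L by exact: lt_le_trans tr.
(* x + t xi is the convex combination of x + (sup L) xi and x with weight
   t / sup L on the former. *)
have p01 : 0 <= t / sup L <= 1.
  by rewrite divr_ge0 ?(ltW t0) ?(ltW r0)//= ler_pdivrMr// mul1r.
have /andP[p0 p1] := p01.
have := vE (x + sup L *: xi) x (Itv01 p0 p1).
rewrite !inE => /(_ Er Ex); congr E.
rewrite /conv/= /unstable.onem scalerBl scale1r scalerDr scalerA.
rewrite divfK ?gt_eqF//.
by rewrite addrC addrA subrK.
Qed.

Lemma radial_funZ (R : realType) (n : nat) (K : set 'rV[R]_n) (c : R)
    (x : 'rV[R]_n) :
  0 < c -> radial_fun K (c *: x) = ((c^-1)%:E * radial_fun K x)%E.
Proof.
move=> c0; rewrite /radial_fun -ereal_sup_pZl ?invr_gt0//.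
congr ereal_sup; apply/seteqP.
split=> [_ [l [l0 Kl] <-]|_ [_ [m [m0 Km] <-] <-]] /=.
  exists (l * c)%:E.
    exists (l * c) => //; split; first exact: mulr_ge0 l0 (ltW c0).
    by rewrite -scalerA.
  by rewrite -EFinM mulrCA mulVf ?gt_eqF// mulr1.
exists (c^-1 * m) => //; split.
  by rewrite mulr_ge0 ?invr_ge0 ?(ltW c0).
by rewrite scalerA mulrAC mulVf ?gt_eqF// mul1r.
Qed.

Lemma eq_star_set (R : realType) (n : nat) (rho1 rho2 : 'rV[R]_n -> \bar R) :
  (forall x, x != 0 -> rho1 x = rho2 x) -> star_set rho1 = star_set rho2.
Proof.
move=> rhoE; apply/seteqP; split=> x; rewrite /star_set/=;
  by have [->|/rhoE ->] := eqVneq x 0; [left|].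
Qed.

(** Homogeneity of degree -1 gives rho (x / c) = c * rho x: dilating a
    star-shaped set multiplies its radial function. *)
Lemma star_setZ (R : realType) (n : nat) (rho : 'rV[R]_n -> \bar R) (c : R) :
  0 < c ->
  (forall a y, 0 < a -> y != 0 -> rho (a *: y) = ((a^-1)%:E * rho y)%E) ->
  [set c *: x | x in star_set rho] = star_set (fun x => c%:E * rho x)%E.
Proof.
move=> c0 rhoZ.
have cK (x : 'rV[R]_n) : c *: (c^-1 *: x) = x.
  by rewrite scalerA mulfV ?gt_eqF// scale1r.
apply/seteqP; split=> [_ [x xK <-]|x xK].
  have [->|x0] := eqVneq x 0; first by left; rewrite scaler0.
  case: xK => [/eqP|x1]; first by rewrite (negbTE x0).
  by right; rewrite rhoZ// muleA -EFinM mulfV ?gt_eqF// mul1e.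
exists (c^-1 *: x) => //.
have [->|x0] := eqVneq x 0; first by left; rewrite scaler0.
case: xK => [/eqP|x1]; first by rewrite (negbTE x0).
by right; rewrite rhoZ ?invr_gt0// invrK.
Qed.

(** A function that is already homogeneous of degree -1 is recovered from its
    values on the sphere. *)
Lemma sphere_ext_id (R : realType) (n : nat) (rho : 'rV[R]_n -> \bar R)
    (x : 'rV[R]_n) :
  (forall a, 0 < a -> rho (a *: x) = ((a^-1)%:E * rho x)%E) ->
  x != 0 -> sphere_ext rho x = rho x.
Proof.
move=> rhoZ x0; have nx := enorm_gt0 x0.
rewrite /sphere_ext rhoZ ?invr_gt0// invrK muleA -EFinM.
by rewrite mulVf ?gt_eqF// mul1e.
Qed.

(** * Exchanging the two integrals *)

Section mean_radial.
Context (R : realType) (n : nat) (E F : set 'rV[R]_n) (alpha : R).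
Hypotheses (cE : compact E)
  (vE : convex_set (E : set (convex_lmodType 'rV[R]_n)))
  (cF : compact F) (FE : F `<=` E) (alpha_gt0 : 0 < alpha).
Variable xi : 'rV[R]_n.
Hypothesis xi_neq0 : xi != 0.

Local Notation mu := (@lebesgue_measure R).

(** The integrand of the double integral, with the condition t > 0 as an
    indicator so that Tonelli's theorem applies on the whole product space. *)
Let kernel (p : measurableTypeR R * 'rV[R]_n) : R :=
  \1_`]0, +oo[ p.1 * p.1 `^ (alpha - 1) * (\1_F p.2 * \1_E (p.2 + p.1 *: xi)).

Let measurable_ray : measurable_fun setT
  (fun p : measurableTypeR R * 'rV[R]_n => p.2 + p.1 *: xi).
Proof.
apply: measurable_fun_rV => i.
rewrite (_ : _ \o _ = fun p => rV_coord i p.2 + p.1 * xi ord0 i); last first.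
  by apply/funext => p; rewrite /= /rV_coord !mxE.
apply: measurable_funD.
  apply: measurableT_comp; first exact: measurable_rV_coord.
  exact: measurable_snd.
by apply: measurable_funM; [exact: measurable_fst|exact: measurable_cst].
Qed.

Let kernel_ge0 p : (0 <= (kernel p)%:E)%E.
Proof. by rewrite lee_fin /kernel !mulr_ge0// powR_ge0. Qed.

Let measurable_kernel : measurable_fun setT (EFin \o kernel).
Proof.
have mE := compact_measurable_rV cE; have mF := compact_measurable_rV cF.
apply/measurable_EFinP; apply: measurable_funM; apply: measurable_funM.
- by apply: measurableT_comp; [exact: measurable_indic|exact: measurable_fst].
- by apply: measurableT_comp (measurable_powR _) _; exact: measurable_fst.
- by apply: measurableT_comp; [exact: measurable_indic|exact: measurable_snd].
- by apply: measurableT_comp measurable_ray; exact: measurable_indic.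
Qed.

(** At fixed x in F, the integrand is t^(alpha-1) on ]0, r] and 0 elsewhere,
    where r is the radial function of E - x at xi. *)
Let integral_kernel1 x : (\int[mu]_t (kernel (t, x))%:E =
  (\1_F x)%:E * ((alpha^-1)%:E *
    radial_fun [set (y - x)%R | y in E] xi `^ alpha))%E.
Proof.
rewrite indicE; have [xF|xF] := boolP (x \in F); last first.
  rewrite mul0e integral0_eq// => t _.
  by rewrite /kernel/= [\1_F x]indicE (negbTE xF) mul0r mulr0.
have [r [r0 -> Er]] := radial_fun_section cE vE (FE (set_mem xF)) xi_neq0.
rewrite mul1e poweR_EFin -EFinM mulrC -integral_powR// [RHS]integral_mkcond.
apply: eq_integral => t _; rewrite patchE /kernel/= [\1_F x]indicE xF mul1r.
rewrite 2!indicE !mem_setE !in_itv/= andbT.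
have [t0|t0] := ltP 0 t; last by rewrite !mul0r.
have -> : (x + t *: xi \in E) = (t <= r).
  by apply/idP/idP => [/set_mem/(Er _ (ltW t0))//|tr]; exact/mem_set/Er/tr/ltW.
by rewrite mul1r; case: (t <= r); rewrite ?mulr1 ?mulr0.
Qed.

Let integral_kernel2 t : (\int[lebesgue_rV R n]_x (kernel (t, x))%:E =
  ((fun t => (t `^ (alpha - 1))%:E *
     \int[lebesgue_rV R n]_x (\1_F x * \1_E (x + t *: xi))%:E)
   \_ `]0%R, +oo[) t)%E.
Proof.
rewrite patchE; case: ifPn => t0; last first.
  rewrite integral0_eq// => x _.
  by rewrite /kernel/= [\1__ t]indicE (negbTE t0) !mul0r.
rewrite -ge0_integralZl//.
- by apply: eq_integral => x _; rewrite /kernel/= [\1__ t]indicE t0 mul1r EFinM.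
- apply/measurable_EFinP/measurable_funM.
    exact: measurable_indic (compact_measurable_rV cF).
  apply: measurableT_comp.
    exact: measurable_indic (compact_measurable_rV cE).
  exact: measurable_fun_pair2 measurable_ray.
- by rewrite lee_fin powR_ge0.
Qed.

(** Tonelli's theorem: integrating the kernel first over x, then over t, gives
    the double integral on the right; integrating first over t gives the
    integral on the left divided by alpha. *)
Lemma integral_mean_radial :
  (\int[lebesgue_rV R n]_(x in F)
     radial_fun [set (y - x)%R | y in E] xi `^ alpha =
   alpha%:E * \int[mu]_(t in `]0%R, +oo[) ((t `^ (alpha - 1))%:E *
     \int[lebesgue_rV R n]_x (\1_F x * \1_E (x + t *: xi))%:E))%E.
Proof.
have mF := compact_measurable_rV cF.
rewrite [X in (_ * X)%E]integral_mkcond.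
under [X in (_ * X)%E]eq_integral => t _ do rewrite -integral_kernel2.
rewrite (fubini_tonelli (EFin \o kernel))//.
rewrite -ge0_integralZl//; last 3 first.
- exact: measurable_fun_fubini_tonelli_G.
- by move=> x _; apply: integral_ge0 => t _; exact: kernel_ge0.
- by rewrite lee_fin ltW.
rewrite [LHS]integral_mkcond; apply: eq_integral => x _.
rewrite integral_kernel1 patchE indicE.
case: ifPn => _; last by rewrite mul0e mule0.
by rewrite mul1e muleA -EFinM mulfV ?gt_eqF// mul1e.
Qed.

(** On F this function is, up to the factor alpha, a partial integral of the
    measurable kernel, hence measurable. *)
Lemma measurable_mean_radial : measurable_fun F
  (fun x => radial_fun [set (y - x)%R | y in E] xi `^ alpha)%E.
Proof.
have mF := compact_measurable_rV cF.
apply: (eq_measurable_fun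
  (fun x => alpha%:E * \int[mu]_t (kernel (t, x))%:E)%E).
  move=> x xF; rewrite integral_kernel1 indicE xF mul1e muleA -EFinM.
  by rewrite mulfV ?gt_eqF// mul1e.
apply: measurable_funS (measurableT) _ _ => //.
apply: measurable_funeM.
exact: (measurable_fun_fubini_tonelli_G (EFin \o kernel)).
Qed.

Lemma mean_radialZ (a : R) : 0 < a ->
  (\int[lebesgue_rV R n]_(x in F)
     radial_fun [set (y - x)%R | y in E] (a *: xi) `^ alpha =
   a^-1%:E `^ alpha * \int[lebesgue_rV R n]_(x in F)
     radial_fun [set (y - x)%R | y in E] xi `^ alpha)%E.
Proof.
move=> a0; rewrite -ge0_integralZl//; last 4 first.
- exact: compact_measurable_rV.
- exact: measurable_mean_radial.
- by move=> x _; exact: poweR_ge0.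
- exact: poweR_ge0.
apply: eq_integral => x /set_mem/FE Ex; rewrite radial_funZ// poweRM//.
  by rewrite lee_fin invr_ge0 ltW.
by have [r [r0 -> _]] := radial_fun_section cE vE Ex xi_neq0.
Qed.

End mean_radial.

(** * Comparison of the two radial functions *)

Theorem lemma9 (R : realType) (n : nat) (E F : set 'rV[R]_n) (alpha : R)
    (E_body : convex_body E) (F_body : convex_body F)
    (F_sub_E : F `<=` E) (alpha_gt0 : 0 < alpha) :
  S_body alpha E F =
  [set (fine (lebesgue_rV R n F) / alpha) `^ alpha^-1 *: x
     | x in R_body alpha E F].
Proof.
have [[cE vE _] [cF _ intF]] := (E_body, F_body).
set v := fine (lebesgue_rV R n F).
have v_gt0 : 0 < v.
  apply: fine_gt0; rewrite lebesgue_rV_compact_lty// andbT.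
  exact: lebesgue_rV_interior_gt0 (compact_measurable_rV cF) intF.
rewrite /R_body -/v; set rho := (X in sphere_ext X).
have rhoZ a y : 0 < a -> y != 0 -> rho (a *: y) = ((a^-1)%:E * rho y)%E.
  move=> a0 y0; rewrite /rho mean_radialZ// muleCA poweRM ?poweR_ge0//;
    last first.
    rewrite mule_ge0 ?lee_fin ?invr_ge0 ?(ltW v_gt0)//.
    by apply: integral_ge0 => x _; exact: poweR_ge0.
  by rewrite -poweRrM mulfV ?gt_eqF// poweRe1// lee_fin invr_ge0 ltW.
rewrite star_setZ; last 2 first.
- by rewrite powR_gt0// divr_gt0.
- by move=> a y a0 _; exact: sphere_extZ.
apply: eq_star_set => x x0.
rewrite sphere_ext_id//; last by move=> a a0; exact: rhoZ.
rewrite /rho integral_mean_radial//.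
set I := (X in (X `^ _)%E = _).
have I_ge0 : (0 <= I)%E.
  apply: integral_ge0 => t _.
  apply: mule_ge0; first by rewrite lee_fin powR_ge0.
  by apply: integral_ge0 => y _; rewrite lee_fin mulr_ge0.
(* The constants cancel: (v / alpha) * v^-1 * alpha = 1. *)
rewrite -poweR_EFin -poweRM ?lee_fin ?divr_ge0 ?(ltW v_gt0) ?(ltW alpha_gt0)//.
  rewrite !muleA -!EFinM [X in (X%:E * _)%E](_ : _ = 1) ?mul1e//.
  by rewrite mulrAC divfK ?gt_eqF// mulfV ?gt_eqF.
by rewrite !mule_ge0 ?lee_fin ?invr_ge0 ?(ltW v_gt0) ?(ltW alpha_gt0).
Qed.
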